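(* For all integers $t\geq2$, \[ \sum_{\lambda\in\mathcal P}d_t(\lambda)\,q^{|\lambda|}=\frac{\sum_{j\geq1}t^j\,G_2^0\left(q^{t^j}\right)}{(q)_{\infty}}, \] where $\mathcal P$ is the set of all integer partitions and $d_t(\lambda)$ is the $t$-defect of $\lambda$.
   Context: Series and products: $G_2^0(q):=\sum_{n\geq1}\frac{nq^n}{1-q^n}=\sum_{n\geq1}\sigma_1(n)q^n$ with $\sigma_1(n)=\sum_{d\mid n}d$, and $(q)_\infty:=\prod_{k\geq1}(1-q^k)$. Identities are between power series in $q$ (formal, or for $|q|<1$). Partitions: $\mathcal P$ is the set of all integer partitions, including the empty partition $\emptyset$; $|\lambda|$ is the sum of the parts of $\lambda$, with $|\emptyset|=0$. For a finite collection (tuple, counted with multiplicity) $X$ of partitions, $|X|$ is the sum of the sizes of the partitions in $X$. $t$-core and $t$-quotient: for $t\ge2$, a $t$-core is a partition none of whose hook lengths is divisible by $t$. The $t$-core $\lambda_{(t)}$ of $\lambda$ is the $t$-core obtained from $\lambda$ by successively removing (rim) hooks of length divisible by $t$ until none remain (the result is independent of choices). The $t$-quotient $\lambda^{(t)}$ is the standard $t$-tuple of partitions defined by the $t$-abacus: pick $N$ divisible by $t$ with $N$ at least the number of parts of $\lambda=(\lambda_1\ge\lambda_2\ge\dots)$ (padded with zeros), let $X=\{\lambda_i+N-i: 1\le i\le N\}$, and for $0\le r\le t-1$ let $X_r=\{x\ge0: tx+r\in X\}$; writing $X_r=\{x_1>x_2>\dots>x_m\}$, the $r$-th component of $\lambda^{(t)}$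 is the partition with parts $x_i-(m-i)$, $1\le i\le m$ (zeros discarded). The map $\lambda\mapsto(\lambda_{(t)},\lambda^{(t)})$ is a bijection from partitions to pairs ($t$-core, $t$-tuple of partitions), and $|\lambda|=|\lambda_{(t)}|+t|\lambda^{(t)}|$. Towers: set $\alpha_0(t;\lambda)=(\lambda)$, and for $j\ge1$ let $\alpha_j(t;\lambda)$ be the tuple of $t^j$ partitions obtained by taking, in order, the $t$-quotients of all the partitions in $\alpha_{j-1}(t;\lambda)$. The $j$-th row $\beta_j(t;\lambda)$ of the $t$-core tower of $\lambda$ is the tuple of $t$-cores of the partitions in $\alpha_j(t;\lambda)$. For each $\lambda$, all the partitions in $\alpha_j(t;\lambda)$ are empty for all sufficiently large $j$. Defect: for every integer $t\ge2$ (not necessarily prime), the $t$-defect of $\lambda$ is \[ d_t(\lambda):=\frac{|\lambda|-\sum_{j\geq0}|\beta_j(t;\lambda)|}{t-1}. \] *)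

(* Defs.v *)
From HB Require Import structures.
From mathcomp Require Import all_boot all_order all_algebra.
From mathcomp Require Import boolp classical_sets functions cardinality fsbigop.
From mathcomp Require Import zify.

Set Implicit Arguments.
Unset Strict Implicit.
Unset Printing Implicit Defensive.

Import GRing.Theory.

Local Open Scope nat_scope.

Definition is_part (s : seq nat) : bool := sorted geq s && (0 \notin s).

Record intpart := IntPart { parts :> seq nat; partsP : is_part parts }.

HB.instance Definition _ := [isSub for parts].
HB.instance Definition _ := [Choice of intpart by <:].

Definition empty_part : intpart := @IntPart [::] isT.

Definition psize (la : intpart) : nat := sumn la.

Definition psize_seq (X : seq intpart) : nat := \sum_(la <- X) psize la.

Lemma geq_trans : transitive geq.
Proof. by move=> y x z /= yx zy; exact: leq_trans zy yx. Qed.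

Lemma is_part_pos (s : seq nat) :
  sorted geq s -> is_part [seq x <- s | 0 < x].
Proof.
move=> ss; rewrite /is_part (sorted_filter geq_trans) //=.
by rewrite mem_filter.
Qed.

Lemma sorted_map_iota (f : nat -> nat) (n : nat) :
  (forall i, i.+1 < n -> f i.+1 <= f i) -> sorted geq [seq f i | i <- iota 0 n].
Proof.
move=> fP; apply/(sortedP 0) => i; rewrite size_map size_iota => lt_i.
by rewrite !(nth_map 0) ?size_iota ?nth_iota ?add0n //; [exact: fP | lia..].
Qed.

Lemma part_nth_le (la : intpart) (i j : nat) :
  i <= j -> nth 0 la j <= nth 0 la i.
Proof.
move=> le_ij; case: (ltnP j (size la)) => [lt_j | /(nth_default 0) -> //].
have /andP[ss _] := partsP la.
apply: (sorted_leq_nth geq_trans leqnn 0 ss) => //.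
exact: leq_ltn_trans le_ij lt_j.
Qed.

(* Rows and columns are numbered from 0. *)
Definition in_diagram (la : intpart) (a b : nat) : bool := b < nth 0 la a.

Definition cells (la : intpart) : seq (nat * nat) :=
  [seq (a, b) | a <- iota 0 (size la), b <- iota 0 (nth 0 la a)].

Definition col_length (la : intpart) (j : nat) : nat := count (ltn j) la.

(* arm + leg + 1 *)
Definition hook_length (la : intpart) (i j : nat) : nat :=
  (nth 0 la i - j.+1) + (col_length la j - i.+1) + 1.

Definition is_tcore (t : nat) (la : intpart) : bool :=
  all (fun c => ~~ (t %| hook_length la c.1 c.2)) (cells la).

(* The cells of the rim hook of la attached to the cell (i, j): the cells weakly
   south-east of (i, j) that have no south-east neighbour in the diagram.
   Their number is the hook length of (i, j). *)
Definition in_rim_hook (la : intpart) (i j a b : nat) : bool :=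
  [&& i <= a, j <= b, in_diagram la a b & ~~ in_diagram la a.+1 b.+1].

Definition rim_removed_row (la : intpart) (i j a : nat) : nat :=
  count (fun b => ~~ in_rim_hook la i j a b) (iota 0 (nth 0 la a)).

Lemma rim_removed_is_part (la : intpart) (i j : nat) :
  is_part [seq x <- [seq rim_removed_row la i j a | a <- iota 0 (size la)]
          | 0 < x].
Proof.
apply: is_part_pos; apply: sorted_map_iota => a _.
rewrite /rim_removed_row.
have le0 := part_nth_le la (leqnSn a).
have le1 := part_nth_le la (leqnSn a.+1).
rewrite -(subnKC le0) iotaD count_cat; apply: leq_trans (leq_addr _ _).
rewrite -!size_filter; apply: uniq_leq_size; first by rewrite filter_uniq ?iota_uniq.
move=> b; rewrite !mem_filter !mem_iota add0n /in_rim_hook /in_diagram.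
by move=> /andP[+ lt_b]; rewrite lt_b andbT /=; lia.
Qed.

Definition remove_rim_hook (la : intpart) (i j : nat) : intpart :=
  IntPart (rim_removed_is_part la i j).

(* Remove one rim hook of length divisible by t, if there is one: the first in
   reading order, the t-core being independent of that choice. *)
Definition tcore_step (t : nat) (la : intpart) : intpart :=
  if [seq c <- cells la | t %| hook_length la c.1 c.2] is c :: _
  then remove_rim_hook la c.1 c.2 else la.

(* |la| steps are enough, see tcore_is_tcore. *)
Definition tcore (t : nat) (la : intpart) : intpart :=
  iter (psize la) (tcore_step t) la.

Lemma mem_cells (la : intpart) (c : nat * nat) :
  (c \in cells la) = (c.1 < size la) && (c.2 < nth 0 la c.1).
Proof.
apply/allpairsPdep/andP => [[a [b [+ + ->]]]|[h1 h2]] /=.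
  by rewrite !mem_iota.
by exists c.1, c.2; rewrite !mem_iota; split => //; case: (c).
Qed.

Lemma sumn_filter_pos (s : seq nat) : sumn [seq x <- s | 0 < x] = sumn s.
Proof. by elim: s => [|[|x] s IHs] //=; rewrite IHs. Qed.

Lemma psize_remove_rim_hook (la : intpart) (c : nat * nat) :
  c \in cells la -> psize (remove_rim_hook la c.1 c.2) < psize la.
Proof.
rewrite mem_cells => /andP[lti ltj].
rewrite /psize /= sumn_filter_pos !sumnE big_map.
rewrite [X in _ < X](big_nth 0) /index_iota subn0.
have c1_in : c.1 \in iota 0 (size la) by rewrite mem_iota.
rewrite !(bigD1_seq c.1 c1_in) ?iota_uniq //=.
rewrite -addSn; apply: leq_add.
  rewrite /rim_removed_row -[X in _ < X](size_iota 0) -[X in _ < X](count_predC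
    (fun b => ~~ in_rim_hook la c.1 c.2 c.1 b)).
  rewrite -addn1 leq_add2l -has_count; apply/hasP.
  exists (nth 0 la c.1).-1; first by rewrite mem_iota; lia.
  rewrite /= negbK /in_rim_hook /in_diagram leqnn /=.
  have := part_nth_le la (leqnSn c.1); lia.
apply: leq_sum => a _; rewrite /rim_removed_row.
by apply: leq_trans (count_size _ _) _; rewrite size_iota.
Qed.

Lemma tcore_stepP (t : nat) (la : intpart) :
  is_tcore t la \/ psize (tcore_step t la) < psize la.
Proof.
rewrite /tcore_step.
case E: [seq c <- cells la | _] => [|c s]; [left | right].
  apply/allP => c c_in; apply/negP => dvd_c.
  suff: c \in ([::] : seq (nat * nat)) by [].
  by rewrite -E mem_filter dvd_c.
apply: psize_remove_rim_hook.
have : c \in c :: s by rewrite inE eqxx.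
by rewrite -E mem_filter => /andP[].
Qed.

Lemma tcore_step_id (t : nat) (la : intpart) :
  is_tcore t la -> tcore_step t la = la.
Proof.
move=> /allP core; rewrite /tcore_step.
case E: [seq c <- cells la | _] => [|c s] //.
have : c \in c :: s by rewrite inE eqxx.
by rewrite -E mem_filter => /andP[dvd_c /core]; rewrite dvd_c.
Qed.

Lemma tcore_is_tcore (t : nat) (la : intpart) : is_tcore t (tcore t la).
Proof.
have core_iter n mu : is_tcore t mu -> iter n (tcore_step t) mu = mu.
  by move=> core; elim: n => //= n ->; exact: tcore_step_id.
suff H n mu : psize mu <= n -> is_tcore t (iter n (tcore_step t) mu) by exact: H.
elim: n mu => [|n IHn] mu le_n; case: (tcore_stepP t mu) => [core|lt_s].
- by rewrite core_iter.
- by lia.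
- by rewrite core_iter.
- by rewrite iterSr; apply: IHn; lia.
Qed.

(* The choice N = t * (number of parts) is
   divisible by t and large enough; the result does not depend on it.
   Both this list and the runners are enumerated in decreasing order. *)
Definition beads (t : nat) (la : intpart) : seq nat :=
  let N := t * size la in [seq nth 0 la i + N - i.+1 | i <- iota 0 N].

Definition runner (t : nat) (la : intpart) (r : nat) : seq nat :=
  [seq x %/ t | x <- beads t la & x %% t == r].

Lemma beads_sorted (t : nat) (la : intpart) : sorted gtn (beads t la).
Proof.
apply/(sortedP 0) => i; rewrite size_map size_iota => lt_i.
rewrite !(nth_map 0) ?size_iota ?nth_iota ?add0n //=; try lia.
have := part_nth_le la (leqnSn i); lia.
Qed.

Lemma runner_sorted (t : nat) (la : intpart) (r : nat) :
  sorted gtn (runner t la r).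
Proof.
have gtn_trans : transitive gtn by move=> y x z /= yx zy; exact: ltn_trans zy yx.
have := sorted_filter gtn_trans (fun x => x %% t == r) (beads_sorted t la).
rewrite /runner; set s := filter _ _ => ss.
have /allP res_s : all (fun x => x %% t == r) s by exact: filter_all.
apply/(sortedP 0) => i; rewrite size_map => lt_i.
have /(_ i lt_i) /= := (sortedP 0 ss).
rewrite !(nth_map 0) ?(ltnW lt_i) //=.
have /eqP := res_s _ (mem_nth 0 lt_i).
have /eqP := res_s _ (mem_nth 0 (ltnW lt_i)).
move: (nth 0 s i) (nth 0 s i.+1) => x y rx ry.
rewrite {1}(divn_eq x t) {1}(divn_eq y t) rx ry ltn_add2r ltn_mul2r.
by move=> /andP[].
Qed.

Definition quot_row (t : nat) (la : intpart) (r i : nat) : nat :=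
  let X := runner t la r in nth 0 X i - (size X - i.+1).

Lemma quot_is_part (t : nat) (la : intpart) (r : nat) :
  is_part [seq x <- [seq quot_row t la r i | i <- iota 0 (size (runner t la r))]
          | 0 < x].
Proof.
apply: is_part_pos; apply: sorted_map_iota => i lt_i.
have /(_ i lt_i) /= := (sortedP 0 (runner_sorted t la r)).
rewrite /quot_row; lia.
Qed.

Definition tquotient_comp (t : nat) (la : intpart) (r : nat) : intpart :=
  IntPart (quot_is_part t la r).

Definition tquotient (t : nat) (la : intpart) : seq intpart :=
  [seq tquotient_comp t la r | r <- iota 0 t].

Fixpoint alpha (t : nat) (la : intpart) (j : nat) : seq intpart :=
  if j is k.+1 then flatten [seq tquotient t mu | mu <- alpha t la k]
  else [:: la].

Definition beta (t : nat) (la : intpart) (j : nat) : seq intpart :=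
  [seq tcore t mu | mu <- alpha t la j].

Local Open Scope classical_set_scope.
Local Open Scope ring_scope.

(* The sum over j in [set: nat] is a finite sum over the support, which is
   finite as the rows of the tower are eventually empty. *)
Definition defect (t : nat) (la : intpart) : rat :=
  ((psize la)%:R - \sum_(j \in [set: nat]) ((psize_seq (beta t la j))%:R : rat))
  / (t%:R - 1).

Lemma finite_psize (n : nat) : finite_set [set la : intpart | psize la = n].
Proof.
pose f (u : n.-tuple 'I_n.+1) : intpart :=
  odflt empty_part (insub [seq x <- map val u | (0 < x)%N]).
apply: (@sub_finite_set _ _ (f @` [set: n.-tuple 'I_n.+1])); last first.
  by apply: finite_image; exact: finite_finset.
move=> la /= sla.
have /andP[_ n0] := partsP la.
have le_in (s : seq nat) x : x \in s -> (x <= sumn s)%N.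
  by elim: s => //= y s IHs; rewrite inE => /orP[/eqP ->|/IHs]; lia.
have size_la : (size la <= n)%N.
  rewrite -sla /psize; elim: (parts la) n0 => //= y s IHs.
  rewrite inE negb_or => /andP[y0 /IHs]; lia.
have sz : size ([seq inord x | x <- la] ++ nseq (n - size la) (ord0 : 'I_n.+1)) == n.
  by rewrite size_cat size_map size_nseq subnKC.
exists (Tuple sz) => //; rewrite /f /=.
rewrite map_cat filter_cat map_nseq.
rewrite [X in _ ++ X](_ : _ = [::]) ?cats0; last first.
  by elim: (n - _)%N => //= k ->.
rewrite -map_comp.
have -> : [seq val (inord x : 'I_n.+1) | x <- la] = la :> seq nat.
  transitivity (map id la); last exact: map_id.
  apply/eq_in_map => x x_in /=.
  have := le_in _ _ x_in; rewrite [sumn _]sla => le_xn.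
  by rewrite inordK.
have -> : [seq x <- la | (0 < x)%N] = la.
  apply/all_filterP/allP => x x_in; rewrite lt0n; apply: contraNneq n0 => <-.
  exact: x_in.
by rewrite valK.
Qed.

Record fps (K : fieldType) := Fps { fcoef : nat -> K }.

HB.instance Definition _ (K : fieldType) := gen_eqMixin (fps K).
HB.instance Definition _ (K : fieldType) := gen_choiceMixin (fps K).

Lemma fpsP (K : fieldType) (f g : fps K) :
  (forall n, fcoef f n = fcoef g n) -> f = g.
Proof. by case: f g => [f] [g] /= fg; congr Fps; apply/funext. Qed.

Definition fps_zero (K : fieldType) : fps K := Fps (fun=> 0).
Definition fps_opp (K : fieldType) (f : fps K) : fps K :=
  Fps (fun n => - fcoef f n).
Definition fps_add (K : fieldType) (f g : fps K) : fps K :=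
  Fps (fun n => fcoef f n + fcoef g n).

Fact fps_addA (K : fieldType) : associative (@fps_add K).
Proof. by move=> f g h; apply: fpsP => n /=; rewrite addrA. Qed.
Fact fps_addC (K : fieldType) : commutative (@fps_add K).
Proof. by move=> f g; apply: fpsP => n /=; rewrite addrC. Qed.
Fact fps_add0 (K : fieldType) : left_id (fps_zero K) (@fps_add K).
Proof. by move=> f; apply: fpsP => n /=; rewrite add0r. Qed.
Fact fps_addN (K : fieldType) :
  left_inverse (fps_zero K) (@fps_opp K) (@fps_add K).
Proof. by move=> f; apply: fpsP => n /=; rewrite addNr. Qed.

HB.instance Definition _ (K : fieldType) := GRing.isZmodule.Build (fps K)
  (@fps_addA K) (@fps_addC K) (@fps_add0 K) (@fps_addN K).

Definition fps_one (K : fieldType) : fps K := Fps (fun n => (n == 0%N)%:R).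
Definition fps_mul (K : fieldType) (f g : fps K) : fps K :=
  Fps (fun n => \sum_(i < n.+1) fcoef f i * fcoef g (n - i)).

(* Truncation, used only to inherit the ring axioms from polynomials. *)
Definition fps_trunc (K : fieldType) (n : nat) (f : fps K) : {poly K} :=
  \poly_(i < n.+1) fcoef f i.

Lemma fps_mul_trunc (K : fieldType) (f g : fps K) (n k : nat) : (k <= n)%N ->
  fcoef (fps_mul f g) k = (fps_trunc n f * fps_trunc n g)`_k.
Proof.
move=> le_kn; rewrite coefM /=; apply: eq_bigr => i _.
by rewrite !coef_poly !ifT //; have := ltn_ord i; lia.
Qed.

Fact fps_mulA (K : fieldType) : associative (@fps_mul K).
Proof.
move=> f g h; apply: fpsP => n.
have tr_mul (u v : fps K) (i : nat) : (i <= n)%N ->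
    (fps_trunc n (fps_mul u v))`_i = (fps_trunc n u * fps_trunc n v)`_i.
  by move=> le_in; rewrite coef_poly ltnS le_in; exact: fps_mul_trunc.
rewrite !(@fps_mul_trunc _ _ _ n) //.
transitivity ((fps_trunc n f * (fps_trunc n g * fps_trunc n h))`_n).
  rewrite coefM [RHS]coefM; apply: eq_bigr => i _.
  by rewrite tr_mul // leq_subr.
rewrite mulrA coefM [RHS]coefM; apply: eq_bigr => i _.
by rewrite tr_mul // -ltnS ltn_ord.
Qed.

Fact fps_mulC (K : fieldType) : commutative (@fps_mul K).
Proof.
by move=> f g; apply: fpsP => n; rewrite !(@fps_mul_trunc _ _ _ n) // mulrC.
Qed.

Fact fps_mul1 (K : fieldType) : left_id (fps_one K) (@fps_mul K).
Proof.
move=> f; apply: fpsP => n /=; rewrite big_ord_recl /= mul1r subn0 big1 ?addr0 //.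
by move=> i _; rewrite mul0r.
Qed.

Fact fps_mulDl (K : fieldType) : left_distributive (@fps_mul K) +%R.
Proof.
move=> f g h; apply: fpsP => n /=; rewrite -big_split /=.
by apply: eq_bigr => i _; rewrite mulrDl.
Qed.

Fact fps_one_neq0 (K : fieldType) : fps_one K != 0.
Proof.
apply/eqP => /(congr1 (fun f => fcoef f 0%N)) /= /eqP.
by rewrite oner_eq0.
Qed.

HB.instance Definition _ (K : fieldType) :=
  GRing.Zmodule_isComNzRing.Build (fps K)
  (@fps_mulA K) (@fps_mulC K) (@fps_mul1 K) (@fps_mulDl K) (@fps_one_neq0 K).

Definition fps_scale (K : fieldType) (c : K) (f : fps K) : fps K :=
  Fps (fun n => c * fcoef f n).

Fact fps_scaleA (K : fieldType) (a b : K) (f : fps K) :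
  fps_scale a (fps_scale b f) = fps_scale (a * b) f.
Proof. by apply: fpsP => n /=; rewrite mulrA. Qed.
Fact fps_scale1 (K : fieldType) : left_id 1 (@fps_scale K).
Proof. by move=> f; apply: fpsP => n /=; rewrite mul1r. Qed.
Fact fps_scaleDr (K : fieldType) : right_distributive (@fps_scale K) +%R.
Proof. by move=> a f g; apply: fpsP => n /=; rewrite mulrDr. Qed.
Fact fps_scaleDl (K : fieldType) (f : fps K) :
  {morph (@fps_scale K)^~ f : a b / a + b}.
Proof. by move=> a b; apply: fpsP => n /=; rewrite mulrDl. Qed.

HB.instance Definition _ (K : fieldType) :=
  GRing.Zmodule_isLmodule.Build K (fps K)
  (@fps_scaleA K) (@fps_scale1 K) (@fps_scaleDr K) (@fps_scaleDl K).

(* The first n coefficients of f^-1, by the recurrence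
   f_0 * b_m = (m == 0) - \sum_(j < m) b_j * f_(m - j). *)
Fixpoint fps_inv_coefs (K : fieldType) (f : fps K) (n : nat) : seq K :=
  if n is m.+1 then
    let b := fps_inv_coefs f m in
    rcons b ((fcoef f 0)^-1 *
             ((m == 0%N)%:R - \sum_(j < m) nth 0 b j * fcoef f (m - j)))
  else [::].

Definition fps_unit (K : fieldType) : pred (fps K) := fun f => fcoef f 0 != 0.

Definition fps_inv (K : fieldType) (f : fps K) : fps K :=
  if fps_unit f then Fps (fun n => nth 0 (fps_inv_coefs f n.+1) n) else f.

Lemma size_fps_inv_coefs (K : fieldType) (f : fps K) (n : nat) :
  size (fps_inv_coefs f n) = n.
Proof. by elim: n => //= n IHn; rewrite size_rcons IHn. Qed.

Lemma nth_fps_inv_coefs (K : fieldType) (f : fps K) (n i : nat) : (i < n)%N ->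
  nth 0 (fps_inv_coefs f n) i = nth 0 (fps_inv_coefs f i.+1) i.
Proof.
elim: n => // n IHn; rewrite ltnS leq_eqVlt => /orP[/eqP -> //|lt_in].
by rewrite [in LHS]/= nth_rcons size_fps_inv_coefs lt_in IHn.
Qed.

Fact fps_mulVf (K : fieldType) :
  {in @fps_unit K, left_inverse 1 (@fps_inv K) *%R}.
Proof.
move=> f uf; have f0 : fcoef f 0 != 0 by exact: uf.
apply: fpsP => n; rewrite /fps_inv ifT //=.
rewrite big_ord_recr /= subnn nth_rcons size_fps_inv_coefs ltnn eqxx.
rewrite mulrAC mulVf // mul1r.
set S1 := (X in X + _); set S2 := (X in _ - X).
have -> : S1 = S2.
  by apply: eq_bigr => i _; rewrite [in RHS]nth_fps_inv_coefs.
by rewrite addrC subrK.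
Qed.

Fact fps_unitPl (K : fieldType) (f g : fps K) : g * f = 1 -> fps_unit f.
Proof.
move=> /(congr1 (fun h => fcoef h 0%N)) /=; rewrite big_ord1 => gf.
by apply/eqP => f0; move/eqP: gf; rewrite subn0 f0 mulr0 eq_sym oner_eq0.
Qed.

Fact fps_inv_out (K : fieldType) : {in [predC @fps_unit K], @fps_inv K =1 id}.
Proof. by move=> f /negbTE uf; rewrite /fps_inv ifF. Qed.

HB.instance Definition _ (K : fieldType) :=
  GRing.ComNzRing_hasMulInverse.Build (fps K)
  (@fps_mulVf K) (@fps_unitPl K) (@fps_inv_out K).

Lemma fcoefD (K : fieldType) (f g : fps K) (n : nat) :
  fcoef (f + g) n = fcoef f n + fcoef g n.
Proof. by []. Qed.
Lemma fcoefN (K : fieldType) (f : fps K) (n : nat) :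
  fcoef (- f) n = - fcoef f n.
Proof. by []. Qed.
Lemma fcoefZ (K : fieldType) (c : K) (f : fps K) (n : nat) :
  fcoef (c *: f) n = c * fcoef f n.
Proof. by []. Qed.
Lemma fcoef1 (K : fieldType) (n : nat) :
  fcoef (1 : fps K) n = (n == 0%N)%:R.
Proof. by []. Qed.
Lemma fcoefM (K : fieldType) (f g : fps K) (n : nat) :
  fcoef (f * g) n = \sum_(i < n.+1) fcoef f i * fcoef g (n - i).
Proof. by []. Qed.

Definition fpsX (K : fieldType) : fps K := Fps (fun n => (n == 1%N)%:R).

Lemma fcoefXM (K : fieldType) (f : fps K) (n : nat) :
  fcoef (fpsX K * f) n = if n is m.+1 then fcoef f m else 0.
Proof.
rewrite fcoefM; case: n => [|n]; first by rewrite big_ord1 mul0r.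
rewrite 2!big_ord_recl /= mul0r add0r mul1r /bump /= subSS subn0 big1 ?addr0 //.
by move=> i _; rewrite mul0r.
Qed.

Lemma fcoefXnM (K : fieldType) (f : fps K) (k n : nat) :
  fcoef (fpsX K ^+ k * f) n = if (n < k)%N then 0 else fcoef f (n - k).
Proof.
elim: k n => [|k IHk] n; first by rewrite expr0 mul1r subn0.
by rewrite exprS -mulrA fcoefXM; case: n => [|n] //; rewrite IHk ltnS subSS.
Qed.

Lemma fcoefXn (K : fieldType) (k n : nat) :
  fcoef (fpsX K ^+ k) n = (n == k)%:R.
Proof.
rewrite -[_ ^+ k]mulr1 fcoefXnM fcoef1.
case: ltnP => le_nk; first by rewrite ltn_eqF.
by congr (nat_of_bool _)%:R; lia.
Qed.

(* The substitution f(q) |-> f(q^m), for m > 0. *)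
Definition fps_dilate (K : fieldType) (m : nat) (f : fps K) : fps K :=
  Fps (fun n => if (m %| n)%N then fcoef f (n %/ m) else 0).

(* The sum of a family in which each coefficient involves only finitely many
   members. *)
Definition fps_sum (K : fieldType) (I : choiceType) (D : set I)
    (F : I -> fps K) : fps K :=
  Fps (fun n => \sum_(i \in D) fcoef (F i) n).

(* The limit of a sequence each coefficient of which is eventually constant. *)
Definition fps_lim (K : fieldType) (u : nat -> fps K) : fps K :=
  Fps (fun n => xget 0 [set a : K |
    exists N : nat, forall m, (N <= m)%N -> fcoef (u m) n = a]).

Lemma fps_limE (K : fieldType) (u : nat -> fps K) (n N : nat) (a : K) :
  (forall m, (N <= m)%N -> fcoef (u m) n = a) -> fcoef (fps_lim u) n = a.
Proof.
move=> Na /=; apply: xget_unique; first by exists N.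
by move=> b [M Mb]; rewrite -(Na (maxn N M)) ?(Mb (maxn N M)) ?leq_maxl ?leq_maxr.
Qed.

Definition qpoch_partial (m : nat) : fps rat :=
  \prod_(1 <= k < m.+1) (1 - fpsX rat ^+ k).

(* (q)_infty *)
Definition qpoch : fps rat := fps_lim qpoch_partial.

Lemma qpochE (n m : nat) : (n <= m)%N ->
  fcoef qpoch n = fcoef (qpoch_partial m) n.
Proof.
have stab d : fcoef (qpoch_partial (n + d)) n = fcoef (qpoch_partial n) n.
  elim: d => [|d IHd]; first by rewrite addn0.
  rewrite addnS.
  have -> : qpoch_partial (n + d).+1 =
      qpoch_partial (n + d) * (1 - fpsX rat ^+ (n + d).+1).
    by rewrite /qpoch_partial big_nat_recr.
  rewrite mulrBr mulr1 fcoefD fcoefN mulrC fcoefXnM ltnS leq_addr.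
  by rewrite subr0.
move=> le_nm; apply: (@fps_limE _ _ _ n) => k le_nk.
by rewrite -(subnKC le_nm) -(subnKC le_nk) !stab.
Qed.

Lemma qpoch_unit : qpoch \is a GRing.unit.
Proof.
suff : fcoef qpoch 0 != 0 by [].
by rewrite (@qpochE 0 0) // /qpoch_partial big_geq // fcoef1 oner_eq0.
Qed.

Definition G20 : fps rat :=
  fps_sum [set n | (0 < n)%N] (fun n =>
    n%:R *: (fpsX rat ^+ n / (1 - fpsX rat ^+ n))).

Lemma fps_geom (n : nat) : (0 < n)%N ->
  (1 - fpsX rat ^+ n)^-1 = Fps (fun k => ((n %| k)%N)%:R).
Proof.
move=> n0; have u : 1 - fpsX rat ^+ n \is a GRing.unit.
  suff : fcoef (1 - fpsX rat ^+ n) 0 != 0 by [].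
  by rewrite fcoefD fcoefN fcoefXn fcoef1 (ltn_eqF n0) subr0 oner_eq0.
apply: (mulrI u); rewrite mulrV //; apply: fpsP => k.
rewrite mulrBl mul1r fcoefD fcoefN fcoefXnM fcoef1 /=.
case: ltnP => [lt_kn|le_nk].
  case: k lt_kn => [|k] lt_kn; first by rewrite dvdn0 subr0.
  by rewrite gtnNdvd ?subr0.
rewrite dvdn_subl // subrr; case: k le_nk => //.
by rewrite leqn0 => /eqP n_eq0; rewrite n_eq0 in n0.
Qed.

Lemma G20_coef (n : nat) : (0 < n)%N ->
  fcoef G20 n = (\sum_(d <- divisors n) d)%:R.
Proof.
move=> n0 /=.
have coefE d : (0 < d)%N ->
    fcoef (d%:R *: (fpsX rat ^+ d / (1 - fpsX rat ^+ d))) n =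
    if (d %| n)%N then d%:R else 0.
  move=> d0; rewrite fcoefZ fps_geom // fcoefXnM /=.
  case: ltnP => [lt_nd|le_dn]; first by rewrite gtnNdvd // mulr0.
  by rewrite dvdn_subl //; case: (d %| n)%N; rewrite ?mulr1 ?mulr0.
rewrite natr_sum [RHS]fsbig_seq ?divisors_uniq //; symmetry.
under [LHS]eq_fsbigr => d.
  rewrite inE /= -dvdn_divisors // => dvd_dn.
  have <- : fcoef (d%:R *: (fpsX rat ^+ d / (1 - fpsX rat ^+ d))) n = d%:R.
    by rewrite coefE ?dvd_dn // (dvdn_gt0 n0).
  over.
apply: fsbig_widen => [d|d [d0]] /=.
  by rewrite -dvdn_divisors //; exact: dvdn_gt0.
by rewrite -dvdn_divisors // => ndvd; rewrite [LHS]coefE // ifN //; apply/negP.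
Qed.

(* Main.v *)
Require Import Defs.
From mathcomp Require Import all_boot all_order all_fingroup all_algebra.
From mathcomp Require Import boolp classical_sets functions cardinality fsbigop.
From mathcomp Require Import finmap zify.
Import GRing.Theory.
Local Open Scope classical_set_scope.
Local Open Scope ring_scope.

(** Encode a partition by its set X of beads. The cells of the diagram
correspond to the pairs made of a bead x and an empty position x - k, with
1 <= k <= x, and k is the hook length of the cell. Let hooks m la be the number
of cells whose hook length is divisible by m, so that hooks 1 la = |la|.

- A pair with t * m | k lies on one runner of the t-abacus, where it becomes a
  pair of the corresponding component of the quotient at a distance divisible
  by m. Thus hooks (t * m) la is the sum of hooks m over the t-quotient
  ([hooks_tquotient]), and the row alpha_j has total size hooks (t ^ j) la
  ([psize_alpha]).
- Removing a rim hook of length t * c slides a bead down by t * c. This lowers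
  the size by t * c and hooks t by c, and a t-core has hooks t = 0. Hence
  |la| = |t-core of la| + t * hooks t la ([psize_tcore]).

Applied to all the partitions in row j, the second point gives
|alpha_j| = |beta_j| + t |alpha_(j+1)|. The sum over j telescopes, and
d_t la = \sum_(j >= 1) hooks (t ^ j) la ([defectE]).

It remains to add up hooks m over the partitions of n. For a fixed k, sliding a
bead from x to x - k is a bijection between the removable hooks of length k
of the partitions of n and the addable ones of the partitions of n - k; and a
partition has exactly k more addable hooks of length k than removable ones. So
the series R_k counting the removable hooks satisfies
R_k = q^k (R_k + k P) with P = \sum_la q^|la|, that is
R_k = k q^k / (1 - q^k) P ([sum_removable_multiples]). Summing over the
multiples k of m gives m G20(q^m) P ([sum_hooks]), and P = 1 / (q)_oo
([partition_gfE]); then take m = t ^ j and sum over j. *)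

Set Implicit Arguments.
Unset Strict Implicit.
Unset Printing Implicit Defensive.

Local Close Scope ring_scope.
Local Close Scope classical_set_scope.
Local Open Scope nat_scope.

(** * Beads and hooks *)

Lemma sum_multiples (t n : nat) (P : pred nat) (F : nat -> nat) : 0 < t ->
  \sum_(1 <= k < n.+1 | (t %| k) && P k) F k =
  \sum_(1 <= d < (n %/ t).+1 | P (t * d)) F (t * d).
Proof.
move=> t0; elim: n => [|n IHn]; first by rewrite div0n !big_geq.
rewrite big_mkcond big_nat_recr //= -big_mkcond IHn divnS //.
have [dv|_] := boolP (t %| n.+1); last by rewrite add0n addn0.
have -> : n.+1 = t * (n %/ t).+1.
  by have := divnS n t0; rewrite dv add1n => <-; rewrite mulnC divnK.
by rewrite add1n [in RHS]big_mkcond big_nat_recr //= -big_mkcond.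
Qed.

Definition bead_list (N : nat) (la : intpart) : seq nat :=
  [seq nth 0 la i + N - i.+1 | i <- iota 0 N].

(** The pairs of a bead x and an empty position x - k, with k divisible by m:
these are the cells whose hook length is a multiple of m. *)
Definition hook_pairs (m : nat) (s : seq nat) : nat :=
  \sum_(x <- s) \sum_(1 <= k < x.+1 | m %| k) (x - k \notin s).

(** The bead added at 0 lies below everything, so it creates no pair. *)
Lemma hook_pairs_shift (m : nat) (s : seq nat) :
  hook_pairs m (rcons (map S s) 0) = hook_pairs m s.
Proof.
rewrite /hook_pairs -cats1 big_cat /= big_seq1 [X in _ + X]big_geq // addn0 big_map.
apply: eq_bigr => x _.
rewrite big_mkcond big_nat_recr //= subnn mem_cat mem_seq1 eqxx orbT if_same addn0.
rewrite -big_mkcond [LHS]big_nat_cond [RHS]big_nat_cond.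
apply: eq_bigr => k /andP[/andP[k1 kx] _].
by rewrite subSn // mem_cat mem_seq1 orbF mem_map // => ? ? [].
Qed.

Lemma bead_listS (N : nat) (la : intpart) : size la <= N ->
  bead_list N.+1 la = rcons (map S (bead_list N la)) 0.
Proof.
move=> leN; rewrite /bead_list -[X in iota 0 X]addn1 iotaD map_cat cats1 /= add0n.
congr rcons; last by rewrite nth_default // addnS; lia.
rewrite -map_comp; apply/eq_in_map => i; rewrite mem_iota /= => ?; lia.
Qed.

Definition hooks (m : nat) (la : intpart) : nat :=
  hook_pairs m (bead_list (size la) la).

(** Raising the number of beads by one shifts all of them and adds a bead at 0,
so any large enough number of beads can be used. *)
Lemma hooksE (N m : nat) (la : intpart) : size la <= N ->
  hooks m la = hook_pairs m (bead_list N la).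
Proof.
move=> leN; rewrite -(subnKC leN); elim: (N - _) => [|d IHd]; first by rewrite addn0.
by rewrite addnS bead_listS ?leq_addr // hook_pairs_shift.
Qed.

Lemma size_bead_list (N : nat) (la : intpart) : size (bead_list N la) = N.
Proof. by rewrite size_map size_iota. Qed.

Lemma nth_bead_list (N i : nat) (la : intpart) : i < N ->
  nth 0 (bead_list N la) i = nth 0 la i + N - i.+1.
Proof. by move=> iN; rewrite (nth_map 0) ?size_iota // nth_iota. Qed.

Lemma bead_list_sorted (N : nat) (la : intpart) : sorted gtn (bead_list N la).
Proof.
apply/(sortedP 0) => i; rewrite size_bead_list => lt_i.
rewrite !nth_bead_list //=; last by lia.
have := part_nth_le la (leqnSn i); lia.
Qed.

Lemma gtn_sorted_uniq (s : seq nat) : sorted gtn s -> uniq s.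
Proof. by rewrite gtn_sorted_uniq_geq => /andP[]. Qed.

Lemma bead_list_uniq (N : nat) (la : intpart) : uniq (bead_list N la).
Proof. exact: gtn_sorted_uniq (bead_list_sorted N la). Qed.

(** Only the set of beads matters, as [bead_list] is sorted. *)
Lemma bead_list_inj (N : nat) (la mu : intpart) : size la <= N -> size mu <= N ->
  bead_list N la =i bead_list N mu -> la = mu.
Proof.
move=> laN muN eqm.
have nth0 : forall nu : intpart, forall i, (nth 0 nu i == 0) = (size nu <= i).
  move=> nu i; apply/eqP/idP => [|/(nth_default 0) //].
  move=> nui; rewrite leqNgt; apply/negP => ilt.
  by have /andP[_ /negP] := partsP nu; apply; rewrite -nui mem_nth.
have eqb : bead_list N la = bead_list N mu.
  apply: (irr_sorted_eq _ _ (bead_list_sorted N la) (bead_list_sorted N mu)) => //.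
    by move=> y x z /= yx zy; exact: ltn_trans zy yx.
  by move=> x /=; rewrite ltnn.
have eqn i : nth 0 la i = nth 0 mu i.
  case: (ltnP i N) => [iN|Ni]; last by rewrite !nth_default //; lia.
  by have := congr1 (nth 0 ^~ i) eqb; rewrite !nth_bead_list //; lia.
apply/val_inj/(@eq_from_nth _ 0) => //=.
by apply/eqP; rewrite eqn_leq -!nth0 eqn nth0 -eqn nth0 !leqnn.
Qed.

Lemma size_le_psize (la : intpart) : size la <= psize la.
Proof.
rewrite /psize; case: la => /= s /andP[_]; elim: s => //= x s IHs.
rewrite inE negb_or => /andP[x0 /IHs]; lia.
Qed.

Lemma sum_bead_list (N : nat) (la : intpart) : size la <= N ->
  \sum_(x <- bead_list N la) x = psize la + 'C(N, 2).
Proof.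
move=> leN; rewrite -bin2_sum.
have -> : psize la = \sum_(0 <= i < N) nth 0 la i.
  rewrite /psize sumnE (big_nth 0) (big_cat_nat (leq0n _) leN) /=.
  rewrite [X in _ = _ + X]big_nat_cond [X in _ = _ + X]big1 ?addn0 // => i.
  by rewrite andbT => /andP[/(nth_default 0)].
rewrite [X in _ = _ + X]big_nat_rev -big_split /= big_map -[X in iota 0 X]subn0.
rewrite [LHS]big_nat_cond [RHS]big_nat_cond; apply: eq_bigr => i.
by rewrite andbT => ?; lia.
Qed.

(** * Hooks and residue classes of beads *)

(** The pairs that [hook_pairs] misses: both positions are beads. *)
Definition class_pairs (t : nat) (s : seq nat) : nat :=
  \sum_(x <- s) count (fun y => (y < x) && (y == x %[mod t])) s.

(** There are x %/ t positions below a bead x in its residue class, each of them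
empty or occupied. *)
Lemma hook_pairs_add_class (t : nat) (s : seq nat) : 0 < t -> uniq s ->
  hook_pairs t s + class_pairs t s = \sum_(x <- s) x %/ t.
Proof.
move=> t0 us; rewrite /hook_pairs /class_pairs -big_split /=; apply: eq_bigr => x _.
have -> : count (fun y => (y < x) && (y == x %[mod t])) s =
   \sum_(1 <= k < x.+1 | t %| k) (x - k \in s).
  rewrite big_mkcond -sum1_count.
  have -> : \sum_(j <- s | (j < x) && (j == x %[mod t])) 1 =
            \sum_(0 <= j < x | (j == x %[mod t])) (j \in s).
    rewrite [RHS](eq_bigr (fun y => if y \in s then 1 else 0)); last first.
      by move=> y _; case: (y \in s).
    rewrite -big_mkcondr -big_filter -[RHS]big_filter.
    apply: perm_big; apply: uniq_perm; rewrite ?filter_uniq ?iota_uniq //.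
    by move=> y; rewrite !mem_filter mem_index_iota /=; lia.
  rewrite big_nat_rev /= add0n -big_mkcond big_add1 /=.
  rewrite [LHS]big_nat_cond [RHS]big_nat_cond; apply: eq_bigl => k.
  apply: andb_id2l => /andP[_ kx]; rewrite eq_sym eqn_mod_dvd ?leq_subr //.
  by rewrite subKn.
rewrite -big_split /=.
rewrite (eq_bigr (fun=> 1)); last by move=> k _; case: (_ \in s).
have := sum_multiples x xpredT (fun=> 1) t0.
under eq_bigl => k do rewrite andbT.
by move=> ->; rewrite sum_nat_const_nat muln1 subSS subn0.
Qed.

(** Two distinct beads of the same class form exactly one ordered pair. *)
Lemma class_pairs_double (t : nat) (s : seq nat) : uniq s ->
  (class_pairs t s).*2 + size s = \sum_(x <- s) count (fun y => y == x %[mod t]) s.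
Proof.
move=> us; rewrite -addnn.
have -> : size s = \sum_(x <- s) count (fun y => y == x) s.
  rewrite -sum1_size; rewrite [LHS]big_seq [RHS]big_seq; apply: eq_bigr => x xs.
  by rewrite count_uniq_mem // xs.
have E : class_pairs t s =
    \sum_(x <- s) count (fun y => (x < y) && (y == x %[mod t])) s.
  rewrite /class_pairs; under eq_bigr => x _ do rewrite -sum1_count big_mkcond.
  rewrite exchange_big /=; apply: eq_bigr => x _; rewrite -sum1_count [RHS]big_mkcond.
  by apply: eq_bigr => y _; rewrite eq_sym.
rewrite {2}E /class_pairs. rewrite -!big_split /=; apply: eq_bigr => x _.
have C p : count p s = \sum_(y <- s) p y by rewrite -sum1_count big_mkcond.
rewrite !C -!big_split /=; apply: eq_bigr => y _.
by case: (ltngtP y x) => [||->] //=; rewrite ?eqxx //; case: (_ == _).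
Qed.

(** By [class_pairs_double] this number depends only on how many beads there are
in each residue class. *)
Lemma class_pairs_mod (t : nat) (s s' : seq nat) : uniq s -> uniq s' ->
  perm_eq [seq x %% t | x <- s] [seq x %% t | x <- s'] ->
  class_pairs t s = class_pairs t s'.
Proof.
have E u : \sum_(x <- u) count (fun y => y == x %[mod t]) u =
    \sum_(r <- [seq x %% t | x <- u]) count_mem r [seq x %% t | x <- u].
  by rewrite big_map; apply: eq_bigr => x _; rewrite count_map.
move=> us us' p; apply: double_inj; apply/eqP.
rewrite -(eqn_add2r (size s)) class_pairs_double // E.
have -> : size s = size s' by have := perm_size p; rewrite !size_map.
rewrite class_pairs_double // E; apply/eqP.
rewrite (perm_big _ p) /=; apply: eq_bigr => r _.
exact: (seq.permP p).
Qed.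

(* sliding one bead down *)
(** Sliding a bead from x to y within its residue class leaves [class_pairs]
unchanged, so the change can be read off from the sum in [hook_pairs_add_class].
The cons cells say that s' is s with x replaced by y. *)
Lemma hook_pairs_slide (t x y : nat) (s s' : seq nat) : 0 < t ->
  uniq s -> uniq s' -> y <= x -> t %| x - y -> perm_eq (x :: s') (y :: s) ->
  hook_pairs t s' + (x - y) %/ t = hook_pairs t s.
Proof.
move=> t0 us us' yx dv p.
have xy : x = y %[mod t] by apply/eqP; rewrite eqn_mod_dvd.
have cp : class_pairs t s' = class_pairs t s.
  apply: class_pairs_mod => //.
  by have := perm_map (modn^~ t) p; rewrite /= xy perm_cons.
have := hook_pairs_add_class t0 us; have := hook_pairs_add_class t0 us'.
have : \sum_(z <- x :: s') z %/ t = \sum_(z <- y :: s) z %/ t by apply: perm_big.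
have xt : x %/ t = (x - y) %/ t + y %/ t by rewrite -{1}(subnK yx) divnDl.
rewrite !big_cons cp; lia.
Qed.

Lemma class_pairs1 (s : seq nat) : uniq s -> class_pairs 1 s = 'C(size s, 2).
Proof.
move=> us; have := class_pairs_double 1 us.
rewrite (eq_bigr (fun=> size s)); last first.
  by move=> x _; rewrite -[RHS]count_predT; apply: eq_count => y /=; rewrite !modn1.
rewrite big_const_seq count_predT iter_addn_0.
rewrite bin2; case: (size s) => [|n] /= e; first by lia.
rewrite -mul2n in e.
have -> : n.+1 * n = class_pairs 1 s * 2 by nia.
by rewrite -divn2 mulnK.
Qed.

Lemma hooks1 (la : intpart) : hooks 1 la = psize la.
Proof.
have := hook_pairs_add_class (ltn0Sn 0) (bead_list_uniq (size la) la).
under eq_bigr => x _ do rewrite divn1.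
rewrite sum_bead_list // class_pairs1 ?bead_list_uniq // size_bead_list.
exact: addIn.
Qed.

(** * Hooks of the quotient *)

Lemma nth_filter_pos (s : seq nat) (i : nat) : sorted geq s ->
  nth 0 [seq x <- s | 0 < x] i = nth 0 s i.
Proof.
elim: s i => // x s IHs i /= ps; have ss := path_sorted ps.
case: x ps => [|x] ps; last by case: i => //= i; exact: IHs.
have z : all (geq 0) s by apply: order_path_min ps; exact: geq_trans.
have E n : nth 0 (0 :: s) n = 0.
  case: n => //= n; case: (ltnP n (size s)) => [nlt|/(nth_default 0) //].
  by have := all_nthP 0 z n nlt; rewrite /= leqn0 => /eqP.
by rewrite IHs // -[nth 0 s i]/(nth 0 (0 :: s) i.+1) !E.
Qed.

Lemma nth_gt_count (s : seq nat) (j a : nat) : sorted geq s ->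
  (j < nth 0 s a) = (a < count (ltn j) s).
Proof.
elim: s a => [|x s IHs] a /=; first by rewrite nth_nil.
move=> ps; have ss := path_sorted ps.
case: (ltnP j x) => jx; first by case: a => [|a] /=; rewrite ?jx // IHs.
have z : all (geq x) s by apply: order_path_min ps; exact: geq_trans.
have -> : count (ltn j) s = 0.
  apply/eqP; rewrite -leqn0 leqNgt -has_count; apply/hasPn => y ys /=.
  have /= := allP z y ys; lia.
case: a => [|a] /=; first by lia.
case: (ltnP a (size s)) => [/(mem_nth 0)/(allP z)|/(nth_default 0) ->] //=; lia.
Qed.

Lemma part_sorted (la : intpart) : sorted geq la.
Proof. by have /andP[] := partsP la. Qed.

Lemma col_lengthP (la : intpart) (j a : nat) :
  (j < nth 0 la a) = (a < col_length la j).
Proof. exact: nth_gt_count (part_sorted la). Qed.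

Lemma col_length_le (la : intpart) (j : nat) : col_length la j <= size la.
Proof. exact: count_size. Qed.

Lemma gtn_sorted_ge (X : seq nat) (i : nat) : sorted gtn X ->
  size X - i.+1 <= nth 0 X i.
Proof.
elim: X i => [|x X IHX] i //= pX; have sX := path_sorted pX.
case: i => [|i] /=; last by rewrite subSS; exact: IHX.
rewrite subn1 /=; case: X pX sX IHX => //= y X /andP[yx _] sX /(_ 0 sX) /=; lia.
Qed.

(** The partition with parts x_i - (m - i) attached to m decreasing positions has
these positions as beads; components of quotients have this form. *)
Lemma bead_listK (X : seq nat) (p : intpart) : sorted gtn X ->
  parts p = [seq x <- [seq nth 0 X i - (size X - i.+1) | i <- iota 0 (size X)]
            | 0 < x] ->
  size p <= size X /\ bead_list (size X) p = X.
Proof.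
move=> sX pE; split.
  by rewrite pE size_filter (leq_trans (count_size _ _)) // size_map size_iota.
apply: (@eq_from_nth _ 0); rewrite size_bead_list // => i iX.
rewrite nth_bead_list // pE nth_filter_pos; last first.
  apply: sorted_map_iota => a aX; have /(_ a aX) /= := (sortedP 0 sX); lia.
rewrite (nth_map 0) ?size_iota // nth_iota // add0n.
have := gtn_sorted_ge i sX; lia.
Qed.

(** A pair at a distance divisible by t lies on a single runner, where its
distance is divided by t. *)
Lemma hook_pairs_runner (t m : nat) (s : seq nat) : 0 < t ->
  hook_pairs (t * m) s =
  \sum_(r <- iota 0 t) hook_pairs m [seq x %/ t | x <- s & x %% t == r].
Proof.
move=> t0; rewrite /hook_pairs.
under [RHS]eq_bigr => r _ do rewrite big_map big_filter big_mkcond.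
rewrite exchange_big /=; apply: eq_bigr => x _.
rewrite (bigD1_seq (x %% t)) /= ?mem_iota ?ltn_mod ?iota_uniq // eqxx.
rewrite [X in _ = _ + X]big1 ?addn0; last by move=> r /negbTE; rewrite eq_sym => ->.
have eA : \sum_(1 <= k < x.+1 | (t %| k) && (m %| k %/ t)) (x - k \notin s) =
    \sum_(1 <= d < (x %/ t).+1 | m %| d) (x - t * d \notin s).
  by rewrite sum_multiples //; apply: eq_bigl => d; rewrite mulKn.
transitivity (\sum_(1 <= k < x.+1 | (t %| k) && (m %| k %/ t)) (x - k \notin s)).
  apply: eq_bigl => k; apply/idP/andP => [dv|[/dvdnP[d ->]]]; last first.
    by rewrite mulnK // => md; rewrite [d * t]mulnC dvdn_mul.
  have tk := dvdn_trans (dvdn_mulr m (dvdnn t)) dv; split => //.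
  by rewrite -(@dvdn_pmul2l t) // [X in _ %| X]mulnC divnK.
rewrite eA [LHS]big_nat_cond [RHS]big_nat_cond; apply: eq_bigr => d.
move=> /andP[/andP[_ dx] _]; congr (nat_of_bool (~~ _)).
have le_td : t * d <= x by rewrite mulnC -leq_divRL.
apply/idP/mapP => [xs|[z]].
  exists (x - t * d).
    rewrite mem_filter xs andbT; apply/eqP.
    by apply/esym/eqP; rewrite eqn_mod_dvd ?leq_subr // subKn // dvdn_mulr.
  by rewrite divnBr ?dvdn_mulr // mulKn.
rewrite mem_filter => /andP[/eqP zx zs] zd.
have -> // : x - t * d = z.
by rewrite (divn_eq x t) (divn_eq z t) -zd zx; nia.
Qed.

Lemma hooks_tquotient (t m : nat) (la : intpart) : 0 < t ->
  hooks (t * m) la = \sum_(mu <- tquotient t la) hooks m mu.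
Proof.
move=> t0; rewrite (@hooksE (t * size la)) ?leq_pmull // hook_pairs_runner //.
rewrite big_map; apply: eq_bigr => r _.
(* The r-th component has the r-th runner as its beads. *)
have [le_s eX] := bead_listK (runner_sorted t la r)
  (erefl (parts (tquotient_comp t la r))).
by rewrite (hooksE _ le_s) eX.
Qed.

Lemma hooks_alpha (t j m : nat) (la : intpart) : 0 < t ->
  \sum_(mu <- alpha t la j) hooks m mu = hooks (t ^ j * m) la.
Proof.
move=> t0; elim: j m => [|j IHj] m /=; first by rewrite big_seq1 mul1n.
rewrite big_flatten big_map expnSr -mulnA -IHj.
by apply: eq_bigr => mu _; rewrite hooks_tquotient.
Qed.

Lemma psize_alpha (t j : nat) (la : intpart) : 0 < t ->
  psize_seq (alpha t la j) = hooks (t ^ j) la.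
Proof.
move=> t0; rewrite -[t ^ j]muln1 -hooks_alpha //.
by apply: eq_bigr => mu _; rewrite hooks1.
Qed.

(** * Removing rim hooks slides beads *)

Lemma count_iota_lt (c n : nat) : count (gtn c) (iota 0 n) = minn c n.
Proof.
elim: n => [|n IHn]; first by rewrite minn0.
rewrite -addn1 iotaD count_cat IHn /= add0n addn0; lia.
Qed.

(** In row a, from i on, the rim hook consists of the columns that are at least j
and at least la_(a+1) - 1. *)
Lemma rim_removed_rowE (la : intpart) (i j a : nat) :
  rim_removed_row la i j a =
  if i <= a then minn (maxn j (nth 0 la a.+1).-1) (nth 0 la a) else nth 0 la a.
Proof.
rewrite /rim_removed_row /in_rim_hook /in_diagram.
case: leqP => [ia|ai]; last by rewrite count_predT size_iota.
rewrite -count_iota_lt; apply: eq_in_count => b; rewrite mem_iota /=; lia.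
Qed.

(** Between row i and the last row of the hook, each row becomes the next one
minus 1, and the last one is cut to length j: the rows shift up by one along the
rim. *)
Lemma nth_remove_rim_hook (la : intpart) (i j a : nat) :
  i < col_length la j ->
  nth 0 (remove_rim_hook la i j) a =
  if (a < i) || (col_length la j <= a) then nth 0 la a
  else if a.+1 == col_length la j then j else (nth 0 la a.+1).-1.
Proof.
move=> ij; have H := col_lengthP la j; have Ha := H a; have Ha1 := H a.+1.
have le1 := part_nth_le la (leqnSn a).
rewrite nth_filter_pos; last first.
  apply: sorted_map_iota => b _; rewrite !rim_removed_rowE.
  have := part_nth_le la (leqnSn b); have := part_nth_le la (leqnSn b.+1).
  have := H b; have := H b.+1; do !case: ifP; lia.
case: (ltnP a (size la)) => [a_lt|le_a]; last first.
  have := col_length_le la j => le_c.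
  rewrite !nth_default ?size_map ?size_iota //; last by lia.
  by rewrite orbC (leq_trans le_c).
rewrite (nth_map 0) ?size_iota // nth_iota // add0n rim_removed_rowE.
do !case: ifP; lia.
Qed.

Lemma hook_length_beads (la : intpart) (i j : nat) : i < col_length la j ->
  hook_length la i j =
  (nth 0 la i + size la - i.+1) - (j + size la - col_length la j).
Proof.
move=> ij; have := col_lengthP la j i; have := col_length_le la j.
rewrite /hook_length; lia.
Qed.

(** The shift of the rows along the rim keeps the beads of the rows after i in the
hook, but one row higher. So the bead of row i disappears and the empty position
attached to column j becomes a bead. *)
Lemma beads_remove_rim_hook (la : intpart) (i j : nat) : i < col_length la j ->
  perm_eq ((nth 0 la i + size la - i.+1)
             :: bead_list (size la) (remove_rim_hook la i j))
          ((j + size la - col_length la j) :: bead_list (size la) la).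
Proof.
move=> ij; set mu := remove_rim_hook la i j.
have le_c := col_length_le la j.
set l := col_length la j in ij le_c *; set N := size la in le_c *.
(* The rows above the hook, those meeting it, and those below it. *)
have iotaE : iota 0 N = iota 0 i ++ iota i (l - i) ++ iota l (N - l).
  have eN : i + (l - i + (N - l)) = N by lia.
  by rewrite -{1}eN !iotaD add0n subnKC // ltnW.
have l0 : l - i = 1 + (l - i.+1) by lia.
pose f (nu : intpart) a := nth 0 nu a + N - a.+1.
have e0 : [seq f mu a | a <- iota 0 i] = [seq f la a | a <- iota 0 i].
  apply/eq_in_map => a; rewrite mem_iota /= add0n => ai.
  by rewrite /f nth_remove_rim_hook // ai.
have e2 : [seq f mu a | a <- iota l (N - l)] = [seq f la a | a <- iota l (N - l)].
  apply/eq_in_map => a; rewrite mem_iota /= => /andP[la_ _].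
  by rewrite /f nth_remove_rim_hook // la_ orbT.
have e1 : [seq f mu a | a <- iota i (l - i)] =
          rcons [seq f la a | a <- iota i.+1 (l - i.+1)] (j + N - l).
  rewrite l0 addnC iotaD map_cat cats1 /=; congr rcons.
    rewrite -[i.+1]addn1 addnC iotaDl -map_comp; apply/eq_in_map => a.
    rewrite mem_iota /f /= !add1n => ai; rewrite nth_remove_rim_hook //.
    have := col_lengthP la j a.+1; rewrite -/l; do !case: ifP; lia.
  rewrite /f nth_remove_rim_hook // -/l; do !case: ifP; lia.
rewrite /bead_list iotaE !map_cat -!/(f _) e0 e1 e2 l0 /=.
apply/seq.permP => p; rewrite /= -/(f la i) add0n -cats1 !count_cat /= count_cat.
set A := count p [seq f la _ | _ <- iota 0 i].
set B := count p [seq _ | _ <- iota i.+1 _].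
set C := count p [seq _ | _ <- iota l _]; lia.
Qed.

Lemma size_remove_rim_hook (la : intpart) (i j : nat) :
  size (remove_rim_hook la i j) <= size la.
Proof. by rewrite size_filter (leq_trans (count_size _ _)) // size_map size_iota. Qed.

Lemma cell_col (la : intpart) (c : nat * nat) :
  c \in cells la -> c.1 < col_length la c.2.
Proof. by rewrite mem_cells -col_lengthP => /andP[]. Qed.

Lemma hooks_remove_rim_hook (t : nat) (la : intpart) (c : nat * nat) :
  0 < t -> c \in cells la -> t %| hook_length la c.1 c.2 ->
  hooks t (remove_rim_hook la c.1 c.2) + hook_length la c.1 c.2 %/ t = hooks t la.
Proof.
move=> t0 /cell_col ij; rewrite hook_length_beads // => dv.
rewrite (hooksE _ (size_remove_rim_hook la c.1 c.2)).
apply: hook_pairs_slide dv _; rewrite ?bead_list_uniq //.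
  by have := col_lengthP la c.2 c.1; lia.
exact: beads_remove_rim_hook.
Qed.

Lemma tcore_stepE (t : nat) (la : intpart) : 0 < t ->
  psize la + t * hooks t (tcore_step t la) =
  psize (tcore_step t la) + t * hooks t la.
Proof.
move=> t0; rewrite /tcore_step.
case E: [seq c <- cells la | _] => [|c s] //.
have : c \in c :: s by rewrite inE eqxx.
rewrite -E mem_filter => /andP[dvd_c c_in].
have := hooks_remove_rim_hook t0 c_in dvd_c.
have := hooks_remove_rim_hook (ltn0Sn 0) c_in (dvd1n _).
rewrite !hooks1 divn1 => <- <-.
by rewrite mulnDr [t * (_ %/ _)]mulnC divnK //; lia.
Qed.

(** The quantity psize - t * hooks t is invariant under removal of hooks of length
divisible by t; the equation avoids the subtraction. *)
Lemma tcoreE (t : nat) (la : intpart) : 0 < t ->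
  psize la + t * hooks t (tcore t la) = psize (tcore t la) + t * hooks t la.
Proof.
move=> t0; rewrite /tcore; move: {2 3}(psize la) => n; elim: n => //= n IHn.
by have := tcore_stepE (iter n (tcore_step t) la) t0; lia.
Qed.

(** * Sizes of cores and the defect *)

(** Every pair comes from a cell. If l beads lie above y, then y corresponds to the
column whose length is l; there are N - l beads below y, so that the column index
is y - (N - l). *)
Lemma hook_cell (la : intpart) (x y : nat) :
  x \in bead_list (size la) la -> y < x -> y \notin bead_list (size la) la ->
  exists2 c, c \in cells la & hook_length la c.1 c.2 = x - y.
Proof.
set X := bead_list _ _; set N := size la => xX yx yX.
set l := count (ltn y) X.
have ltX : forall a, (y < nth 0 X a) = (a < l).
  by move=> a; apply: nth_gt_count; apply: sub_sorted (bead_list_sorted _ _) => u v /= /ltnW.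
have lN : l <= N by rewrite -(size_bead_list N la) count_size.
have [i iN xE] : exists2 i, i < N & x = nth 0 la i + N - i.+1.
  by move: xX => /mapP[i]; rewrite mem_iota => /andP[_ iN ->]; exists i.
have il : i < l by rewrite -ltX nth_bead_list // -xE.
have Ny : N - l <= y.
  have <- : count (gtn y) X = N - l.
    rewrite -(size_bead_list N la) -(count_predC (ltn y)) -/l addKn.
    apply: eq_in_count => z zX /=; rewrite -leqNgt ltn_neqAle.
    by rewrite (_ : z != y) //; apply: contraNneq yX => <-.
  rewrite -size_filter -[X in _ <= X](size_iota 0); apply: uniq_leq_size.
    by rewrite filter_uniq ?bead_list_uniq.
  by move=> z; rewrite mem_filter mem_iota => /andP[].
pose j := y - (N - l).
(* Exactly the first l rows reach beyond column j. *)
have jP a : (j < nth 0 la a) = (a < l).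
  case: (ltnP a l) => al.
    have /= le_a := part_nth_le la (_ : a <= l.-1).
    have := ltX l.-1; rewrite nth_bead_list; lia.
  have le_a := part_nth_le la al.
  case: (ltnP l N) => lN'; last by rewrite nth_default //; lia.
  have := ltX l; rewrite ltnn nth_bead_list //.
  have : nth 0 X l != y by apply: contraNneq yX => <-; rewrite mem_nth ?size_bead_list.
  rewrite nth_bead_list //; lia.
have jl : col_length la j = l.
  apply/eqP; rewrite eqn_leq leqNgt -col_lengthP jP ltnn /=.
  by rewrite leqNgt -jP col_lengthP ltnn.
exists (i, j); first by rewrite mem_cells /= jP il iN.
rewrite /= hook_length_beads jl // -/N xE; lia.
Qed.

(** By [hook_cell], such a pair would give a hook length divisible by t. *)
Lemma hooks_tcore (t : nat) (la : intpart) : 0 < t -> hooks t (tcore t la) = 0.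
Proof.
move=> t0; have /allP core := tcore_is_tcore t la; set mu := tcore t la in core *.
rewrite /hooks /hook_pairs big_seq big1 // => x xX; rewrite big_nat_cond big1 // => k.
move=> /andP[/andP[k0 kx] tk]; apply/eqP; rewrite eqb0 negbK; apply/negPn/negP => kX.
have [|c c_in hc] := hook_cell xX _ kX; first by lia.
by have := core c c_in; rewrite hc subKn ?tk // -ltnS.
Qed.

Lemma psize_tcore (t : nat) (la : intpart) : 0 < t ->
  psize la = psize (tcore t la) + t * hooks t la.
Proof. by move=> t0; rewrite -tcoreE // hooks_tcore // muln0 addn0. Qed.

Lemma psize_beta (t j : nat) (la : intpart) : 0 < t ->
  hooks (t ^ j) la = psize_seq (beta t la j) + t * hooks (t ^ j.+1) la.
Proof.
move=> t0; rewrite -psize_alpha // expnSr -hooks_alpha // /psize_seq big_map.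
rewrite big_distrr -big_split; apply: eq_bigr => mu _; exact: psize_tcore.
Qed.

(** The sizes of the rows decrease at least like t ^ - j, which makes the tower
finite. *)
Lemma hooks_le (t j : nat) (la : intpart) : 0 < t ->
  t ^ j * hooks (t ^ j) la <= psize la.
Proof.
move=> t0; elim: j => [|j IHj]; first by rewrite mul1n hooks1.
apply: leq_trans IHj; rewrite expnSr -mulnA leq_mul2l -expnSr (psize_beta j) //.
by rewrite leq_addl orbT.
Qed.

Lemma hooks_eq0 (t j : nat) (la : intpart) : 1 < t -> psize la <= j ->
  hooks (t ^ j) la = 0.
Proof.
move=> t1 le_j; have := hooks_le j la (ltnW t1); have := ltn_expl j t1.
by case: (hooks _ _) => // h; nia.
Qed.

Local Open Scope classical_set_scope.
Local Open Scope ring_scope.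

(** Sum |alpha_j| = |beta_j| + t |alpha_(j+1)| over j <= n. As |alpha_(n+1)| = 0,
what is left is |la| = \sum_j |beta_j| + (t - 1) \sum_(1 <= j <= n) |alpha_j|. *)
Lemma defectE (t n : nat) (la : intpart) : (1 < t)%N -> (psize la <= n)%N ->
  defect t la = (\sum_(1 <= j < n.+1) hooks (t ^ j) la)%:R.
Proof.
move=> t1 le_n; have t0 := ltnW t1; rewrite /defect.
have t1n0 : (t%:R - 1 : rat) != 0.
  by rewrite subr_eq0 -[1]/(1%:R) Num.Theory.eqr_nat gtn_eqF.
have beta0 j : (psize la < j.+1)%N -> psize_seq (beta t la j) = 0%N.
  by move=> le_j; have := psize_beta j la t0; rewrite hooks_eq0 //; lia.
have -> : \sum_(j \in [set: nat]) ((psize_seq (beta t la j))%:R : rat) =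
    \sum_(0 <= j < n.+1) (psize_seq (beta t la j))%:R.
  rewrite [RHS]fsbig_seq ?iota_uniq //; symmetry; apply: fsbig_widen => // j [_ /=].
  by move=> /negP; rewrite mem_index_iota -leqNgt /= => nj; rewrite beta0 //; lia.
rewrite -natr_sum; apply: (canLR (mulfK t1n0)).
have H : (psize la + \sum_(1 <= j < n.+1) hooks (t ^ j) la =
  \sum_(0 <= j < n.+1) psize_seq (beta t la j) +
  t * \sum_(1 <= j < n.+1) hooks (t ^ j) la)%N.
  have -> : (\sum_(1 <= j < n.+1) hooks (t ^ j) la =
             \sum_(0 <= j < n.+1) hooks (t ^ j.+1) la)%N.
    by rewrite [RHS]big_nat_recr //= hooks_eq0 ?leqW // addn0 big_add1.
  rewrite big_distrr -big_split /= -{1}hooks1 -(expn0 t).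
  rewrite (eq_bigr _ (fun j _ => esym (psize_beta j la t0))).
  by rewrite [RHS]big_nat_recl //= [in LHS]big_nat_recr //=
    (@hooks_eq0 t n.+1) ?leqW // addn0.
rewrite mulrBr mulr1 -natrM; apply/eqP; rewrite subr_eq addrAC eq_sym subr_eq.
move/(congr1 (fun k => k%:R : rat)): H; rewrite !natrD mulnC => H.
by rewrite H addrC.
Qed.

Local Close Scope ring_scope.
Local Close Scope classical_set_scope.

(** * Hooks of a given length in all partitions of n *)

Definition partitions (n : nat) : seq intpart :=
  fset_set [set la : intpart | psize la = n]%classic.

Lemma mem_partitions (n : nat) (la : intpart) :
  (la \in partitions n) = (psize la == n).
Proof.
have := in_fset_set (finite_psize n) la; rewrite /partitions => ->.
by apply/idP/eqP => [/set_mem //|?]; exact/mem_set.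
Qed.

Lemma partitions_uniq (n : nat) : uniq (partitions n).
Proof. exact: fset_uniq. Qed.

Lemma bead_bound (N x : nat) (la : intpart) :
  x \in bead_list N la -> x < N + psize la.
Proof.
move=> /mapP[i]; rewrite mem_iota /= add0n => iN ->.
suff : nth 0 la i <= psize la by lia.
rewrite /psize; elim: (parts la) i {iN} => [|y s IHs] [|i] //=; first by rewrite leq_addr.
exact: leq_trans (IHs i) (leq_addl _ _).
Qed.

(** Every set of N positions is the set of the N beads of some partition. *)
Lemma bead_list_set (M : nat) (S : {set 'I_M}) :
  exists2 p : intpart, size p <= #|S| &
    perm_eq (bead_list #|S| p) [seq val x | x in S].
Proof.
pose X := sort geq [seq val x | x <- enum S].
have uX : uniq X by rewrite sort_uniq map_inj_uniq ?enum_uniq //; exact: val_inj.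
have sX : sorted gtn X.
  rewrite gtn_sorted_uniq_geq uX sort_sorted // => x y; exact: leq_total.
have sizeX : size X = #|S| by rewrite size_sort size_map cardE.
have pX : is_part [seq x <- [seq nth 0 X i - (size X - i.+1)
                            | i <- iota 0 (size X)] | 0 < x].
  apply: is_part_pos; apply: sorted_map_iota => a aX.
  have /(_ a aX) /= := (sortedP 0 sX); lia.
have [le_p eqX] := bead_listK sX (erefl (parts (IntPart pX))).
by exists (IntPart pX); rewrite -sizeX // eqX perm_sort.
Qed.

Lemma sum_bead_list_set (M : nat) (S : {set 'I_M}) (p : intpart) :
  size p <= #|S| -> perm_eq (bead_list #|S| p) [seq val x | x in S] ->
  \sum_(x in S) x = psize p + 'C(#|S|, 2).
Proof. by move=> le_p pS; rewrite -sum_bead_list // (perm_big _ pS) big_image. Qed.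

Lemma sum_ord_mem (M : nat) (X : seq nat) (F : nat -> nat) : uniq X ->
  (forall x, x \in X -> x < M) ->
  \sum_(x : 'I_M | val x \in X) F x = \sum_(x <- X) F x.
Proof.
move=> uX ltX; rewrite -(big_mkord (fun x => x \in X)) -big_filter.
apply: perm_big; apply: uniq_perm; rewrite ?filter_uniq ?iota_uniq //.
move=> x; rewrite mem_filter mem_index_iota /=.
by case: (boolP (x \in X)) => // /ltX ->.
Qed.

Definition bead_set (M N : nat) (la : intpart) : {set 'I_M} :=
  [set x : 'I_M | val x \in bead_list N la].

Lemma sum_bead_set (M N : nat) (la : intpart) (F : nat -> nat) :
  N + psize la <= M ->
  \sum_(x in bead_set M N la) F x = \sum_(x <- bead_list N la) F x.
Proof.
move=> le_M; rewrite -(@sum_ord_mem M) ?bead_list_uniq //.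
  by apply: eq_bigl => x; rewrite inE.
by move=> x /bead_bound xl; exact: leq_trans xl le_M.
Qed.

Lemma card_bead_set (M N : nat) (la : intpart) :
  N + psize la <= M -> #|bead_set M N la| = N.
Proof.
move=> le_M; rewrite -sum1_card (sum_bead_set (fun=> 1)) //.
by rewrite sum1_size size_bead_list.
Qed.

(** A partition of n is the same thing as a set of N positions with sum
n + (0 + 1 + ... + (N - 1)). On these finite sets beads can be moved without
having to build the new partition. *)
Lemma sum_partitions_sets (M N n : nat) (f : {set 'I_M} -> nat) :
  n <= N -> N + n <= M ->
  \sum_(la <- partitions n) f (bead_set M N la) =
  \sum_(S : {set 'I_M} | (#|S| == N) && (\sum_(x in S) x == n + 'C(N, 2))) f S.
Proof.
move=> nN NM; rewrite -(big_map _ xpredT) -[RHS]big_enum.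
have size_n la : la \in partitions n -> psize la = n /\ size la <= N.
  rewrite mem_partitions => /eqP la_n; split=> //.
  by apply: leq_trans nN; rewrite -la_n size_le_psize.
apply: perm_big; apply: uniq_perm; rewrite ?enum_uniq //.
  rewrite map_inj_in_uniq ?partitions_uniq // => la mu /size_n[la_n laN] /size_n[mu_n muN].
  move=> eqS; apply: (bead_list_inj laN muN) => x.
  case: (ltnP x M) => xM; last first.
    by apply/idP/idP => /bead_bound; rewrite ?la_n ?mu_n; lia.
  by have /setP/(_ (Ordinal xM)) := eqS; rewrite !inE.
move=> S; rewrite mem_enum [RHS]inE; apply/mapP/andP => [[la /size_n[la_n laN] ->]|].
  rewrite card_bead_set ?la_n // eqxx (sum_bead_set id) ?la_n //.
  by rewrite sum_bead_list // la_n.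
move=> [/eqP SN /eqP Sn]; have [p le_p pS] := bead_list_set S.
have Sp := sum_bead_list_set le_p pS; rewrite SN in le_p pS Sp.
exists p; last first.
  apply/setP => x; rewrite inE (perm_mem pS) mem_map ?mem_enum //; exact: val_inj.
by rewrite mem_partitions -(eqn_add2r 'C(N, 2)) -Sn Sp.
Qed.

(** The cells with hook length exactly k. *)
Definition removable (k : nat) (s : seq nat) : nat :=
  \sum_(x <- s) ((k <= x) && (x - k \notin s)).

(** The ways of adding a rim hook of length k. *)
Definition addable (k : nat) (s : seq nat) : nat :=
  \sum_(x <- s) (x + k \notin s).

(** Among the N beads, those that cannot be slid up by k are matched, by adding k,
with those that have a bead k positions below. The beads that cannot be slid down
by k are the latter and the k beads at the bottom. *)
Lemma addable_removable (k N : nat) (la : intpart) : size la + k <= N ->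
  addable k (bead_list N la) = removable k (bead_list N la) + k.
Proof.
move=> le_N; set X := bead_list N la.
have uX : uniq X := bead_list_uniq N la.
(* The k lowest positions are beads, as la has at most N - k parts. *)
have ek : count (gtn k) X = k.
  rewrite -size_filter -[RHS](size_iota 0); apply/perm_size/uniq_perm.
  - by rewrite filter_uniq.
  - exact: iota_uniq.
  move=> z; rewrite mem_filter mem_iota add0n /=; apply: andb_idr => zk.
  apply/mapP; exists (N - z.+1); first by rewrite mem_iota; lia.
  rewrite nth_default; lia.
have em : count (fun y => y + k \in X) X = count (fun x => (k <= x) && (x - k \in X)) X.
  rewrite -!size_filter -(size_map (addn^~ k)); apply/perm_size/uniq_perm.
  - by rewrite map_inj_uniq ?filter_uniq //; exact: addIn.
  - by rewrite filter_uniq.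
  move=> z; rewrite mem_filter; apply/mapP/andP => [[y]|[/andP[kz zkX] zX]].
    by rewrite mem_filter => /andP[ykX yX] ->; rewrite addnK leq_addl yX.
  by exists (z - k); rewrite ?mem_filter ?subnK ?zX ?zkX.
have C (p : pred nat) : count p X = \sum_(x <- X) p x by rewrite -sum1_count big_mkcond.
have eA : addable k X + count (fun y => y + k \in X) X = size X.
  rewrite C -sum1_size -big_split; apply: eq_bigr => y _ /=; by case: (_ \in X).
have eR : removable k X + count (fun x => (k <= x) && (x - k \in X)) X +
    count (gtn k) X = size X.
  rewrite !C -sum1_size -!big_split; apply: eq_bigr => y _ /=.
  by case: leqP => //= ky; case: (_ \in X).
lia.
Qed.

Lemma sum_tperm (M : nat) (S : {set 'I_M}) (x u : 'I_M) :
  u \in S -> x \notin S ->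
  \sum_(z in [set tperm x u z | z in S]) z + u = \sum_(z in S) z + x.
Proof.
move=> uS xS; rewrite big_imset /=; last by move=> ? ? _ _; exact: perm_inj.
rewrite (bigD1 u) //= tpermR [in RHS](bigD1 u) //=.
rewrite (eq_bigr (fun z : 'I_M => z : nat)); first by lia.
move=> z /andP[zS zu]; rewrite tpermD // 1?eq_sym //.
by apply: contraNneq xS => <-.
Qed.

(** Slide the bead: swapping x and x - k turns a bead set of total n + 'C(N, 2)
with a bead at x and none at x - k into one of total n - k + 'C(N, 2) with a bead
at x - k and none at x. The swap is an involution on sets of positions. *)
Lemma sum_removable (k N n : nat) : n <= N ->
  \sum_(la <- partitions n) removable k (bead_list N la) =
  if k <= n then \sum_(la <- partitions (n - k)) (removable k (bead_list N la) + k)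
  else 0.
Proof.
move=> nN; pose M := N + n.
pose u (x : 'I_M) : 'I_M := Ordinal (leq_ltn_trans (leq_subr k x) (ltn_ord x)).
pose f (S : {set 'I_M}) := \sum_(x : 'I_M | k <= x) ((x \in S) && (u x \notin S)).
pose g (S : {set 'I_M}) := \sum_(x : 'I_M | k <= x) ((x \notin S) && (u x \in S)).
pose sw (x : 'I_M) (S : {set 'I_M}) := [set tperm x (u x) z | z in S].
have swI x : injective (sw x) by apply: imset_inj; exact: perm_inj.
have -> : \sum_(la <- partitions n) removable k (bead_list N la) =
          \sum_(la <- partitions n) f (bead_set M N la).
  rewrite [LHS]big_seq [RHS]big_seq; apply: eq_bigr => la.
  rewrite mem_partitions => /eqP la_n; rewrite /removable.
  rewrite -(sum_bead_set (M := M) (fun x => (k <= x) && _ : nat)) ?la_n //.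
  rewrite big_mkcond /f [RHS]big_mkcond; apply: eq_bigr => x _.
  by rewrite !inE /=; case: ifP => //; case: leqP.
have eq_fg (c : nat) :
    \sum_(S : {set 'I_M} | (#|S| == N) && (\sum_(x in S) x == c)) f S =
    \sum_(S : {set 'I_M} | (#|S| == N) && (\sum_(x in S) x + k == c)) g S.
  rewrite exchange_big [RHS]exchange_big /=; apply: eq_bigr => x kx.
  rewrite (reindex_inj (swI x)) big_mkcond [RHS]big_mkcond; apply: eq_bigr => T _.
  have sxT : (x \in sw x T) = (u x \in T).
    by rewrite -{1}(tpermR x (u x)) mem_imset //; exact: perm_inj.
  have suT : (u x \in sw x T) = (x \in T).
    by rewrite -{1}(tpermL x (u x)) mem_imset //; exact: perm_inj.
  rewrite sxT suT card_imset; last exact: perm_inj.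
  case: (boolP (x \in T)) => xT; first by rewrite andbF !if_same.
  case: (boolP (u x \in T)) => uT; last by rewrite !if_same.
  (* Only the case of a bead at x - k and none at x remains; swapping adds k. *)
  suff -> : \sum_(z in sw x T) z = \sum_(z in T) z + k by [].
  apply: (@addIn (u x)); rewrite -addnA [k + _]addnC (subnK kx); exact: sum_tperm.
rewrite sum_partitions_sets // eq_fg; case: leqP => kn; last first.
  rewrite big1 // => S /andP[/eqP SN /eqP Sn].
  (* No N distinct positions have a sum below 'C(N, 2). *)
  have [p le_p pS] := bead_list_set S.
  have := sum_bead_list_set le_p pS; rewrite SN; lia.
transitivity (\sum_(la <- partitions (n - k)) g (bead_set M N la)).
  rewrite sum_partitions_sets; [|lia..].
  by apply: eq_bigl => S; congr andb; lia.
rewrite [LHS]big_seq [RHS]big_seq; apply: eq_bigr => la.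
rewrite mem_partitions => /eqP la_n.
have le_la := size_le_psize la.
rewrite -addable_removable; last by lia.
set X := bead_list N la.
have ltM x : x \in X -> x + k < M by move=> /bead_bound; lia.
have -> : addable k X = \sum_(x <- [seq y + k | y <- X]) (x \notin X).
  by rewrite big_map.
rewrite -(@sum_ord_mem M); last 2 first.
- by rewrite (map_inj_uniq (@addIn k)) bead_list_uniq.
- by move=> _ /mapP[y yX ->]; exact: ltM.
rewrite /g big_mkcond [RHS]big_mkcond; apply: eq_bigr => x _; rewrite !inE /= -/X.
have -> : (val x \in [seq y + k | y <- X]) = (k <= x) && (x - k \in X).
  apply/mapP/andP => [[y yX ->]|[kx xX]]; first by rewrite addnK leq_addl.
  by exists (x - k); rewrite ?subnK.
by case: leqP => //= _; case: (x - k \in X); rewrite ?andbF ?andbT.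
Qed.

(** This is R_k = q^k (R_k + k P) solved for R_k, coefficient by coefficient. *)
Lemma sum_removable_multiples (k n N : nat) : 0 < k -> n <= N ->
  \sum_(la <- partitions n) removable k (bead_list N la) =
  \sum_(1 <= i < n.+1 | k %| i) k * size (partitions (n - i)).
Proof.
move=> k0; have [m] := ubnP n; elim: m n => // m IHm n nm nN.
have E r := sum_multiples r xpredT (fun i => k * size (partitions (n - i))) k0.
have {}E : \sum_(1 <= i < n.+1 | k %| i) k * size (partitions (n - i)) =
    \sum_(1 <= d < (n %/ k).+1) k * size (partitions (n - k * d)).
  by rewrite -E; apply: eq_bigl => i; rewrite andbT.
rewrite sum_removable // E; case: leqP => kn; last by rewrite divn_small // big_geq.
have E' := sum_multiples (n - k) xpredT (fun i => k * size (partitions (n - k - i))) k0.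
have {}E' : \sum_(1 <= i < (n - k).+1 | k %| i) k * size (partitions (n - k - i)) =
    \sum_(1 <= d < ((n - k) %/ k).+1) k * size (partitions (n - k - k * d)).
  by rewrite -E'; apply: eq_bigl => i; rewrite andbT.
rewrite big_split /= IHm; [|lia..].
rewrite E' big_const_seq count_predT iter_addn_0.
have -> : n %/ k = ((n - k) %/ k).+1 by rewrite -{1}(subnK kn) divnDr // divnn k0 addn1.
rewrite [RHS]big_nat_recl // muln1 addnC; congr addn.
by apply: eq_bigr => d _; rewrite mulnS subnDA.
Qed.

Lemma sum_dvd_divisors (m n : nat) : 0 < m -> 0 < n ->
  \sum_(1 <= k < n.+1 | (m %| k) && (k %| n)) k =
  if m %| n then m * \sum_(d <- divisors (n %/ m)) d else 0.
Proof.
move=> m0 n0; rewrite sum_multiples //; case: ifP => [/dvdnP[q qn]|ndv]; last first.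
  by rewrite big1 // => d /(dvdn_trans (dvdn_mulr d (dvdnn m))); rewrite ndv.
have q0 : 0 < q by move: n0; rewrite qn; case: q {qn}.
rewrite qn mulnK // big_distrr -big_filter /=; apply: perm_big; apply: uniq_perm.
- by rewrite filter_uniq ?iota_uniq.
- exact: divisors_uniq.
move=> d; rewrite mem_filter mem_index_iota -dvdn_divisors // mulnC dvdn_pmul2r //.
case: (boolP (d %| q)) => // dq.
by rewrite (dvdn_gt0 q0 dq) ltnS (dvdn_leq q0 dq).
Qed.

Lemma hook_pairs_removable (m K : nat) (s : seq nat) :
  (forall x, x \in s -> x < K) ->
  hook_pairs m s = \sum_(1 <= k < K | m %| k) removable k s.
Proof.
move=> ltK; rewrite /hook_pairs /removable exchange_big /=.
rewrite [LHS]big_seq [RHS]big_seq; apply: eq_bigr => x /ltK xK.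
rewrite [RHS](big_cat_nat _ xK) //= [X in _ = _ + X]big_nat_cond.
rewrite [X in _ = _ + X]big1 ?addn0; last first.
  by move=> k /andP[/andP[xk _] _]; rewrite leqNgt xk.
rewrite [LHS]big_nat_cond [RHS]big_nat_cond; apply: eq_bigr => k.
by move=> /andP[/andP[_ kx] _]; rewrite -ltnS kx.
Qed.

(** Add up [sum_removable_multiples] over the multiples k of m; the factor of
p(n - i) is the sum of the multiples of m that divide i. *)
Lemma sum_hooks (m n : nat) : 0 < m ->
  \sum_(la <- partitions n) hooks m la =
  \sum_(1 <= i < n.+1 | m %| i)
    (m * \sum_(d <- divisors (i %/ m)) d) * size (partitions (n - i)).
Proof.
move=> m0; pose K := n + n.+1.
transitivity (\sum_(la <- partitions n)
    \sum_(1 <= k < K | m %| k) removable k (bead_list n la)).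
  rewrite [LHS]big_seq [RHS]big_seq; apply: eq_bigr => la.
  rewrite mem_partitions => /eqP la_n; rewrite (@hooksE n) -?la_n ?size_le_psize //.
  by apply: hook_pairs_removable => x /bead_bound; rewrite la_n /K; lia.
rewrite exchange_big /=.
transitivity (\sum_(1 <= k < K | m %| k)
    \sum_(1 <= i < n.+1 | k %| i) k * size (partitions (n - i))).
  rewrite [LHS]big_nat_cond [RHS]big_nat_cond; apply: eq_bigr => k.
  by move=> /andP[/andP[k0 _] _]; rewrite sum_removable_multiples.
rewrite (exchange_big_dep xpredT) //= [RHS]big_mkcond.
rewrite [LHS]big_nat_cond [RHS]big_nat_cond; apply: eq_bigr => i.
rewrite andbT => /andP[i0 i_n].
rewrite -big_distrl /=; have := sum_dvd_divisors m0 i0.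
rewrite (_ : \sum_(1 <= k < K | _) k = \sum_(1 <= k < i.+1 | (m %| k) && (k %| i)) k).
  by move=> ->; case: ifP.
have iK : i.+1 <= K by rewrite /K; lia.
rewrite (big_cat_nat _ iK) //= [X in _ + X]big_nat_cond [X in _ + X]big1 ?addn0 //.
move=> k /andP[/andP[ik _] /andP[_ /(dvdn_leq i0)]]; lia.
Qed.

(** * The generating function of partitions *)

Definition partitions_le (m n : nat) : seq intpart :=
  [seq la <- partitions n | head 0 (parts la) <= m].

Lemma mem_map_parts (n : nat) (a : pred (seq nat)) (s : seq nat) :
  (s \in [seq parts la | la <- partitions n & a (parts la)]) =
  [&& is_part s, sumn s == n & a s].
Proof.
apply/mapP/and3P => [[la]|[sp sn sa]].
  by rewrite mem_filter mem_partitions => /andP[ala la_n] ->; split=> //; exact: partsP.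
by exists (IntPart sp) => //; rewrite mem_filter mem_partitions sa.
Qed.

Lemma is_part_cons (m : nat) (s : seq nat) :
  is_part (m.+1 :: s) = is_part s && (head 0 s <= m.+1).
Proof.
rewrite /is_part inE /=; case: s => //= y s.
by rewrite -andbA andbC.
Qed.

(** Split according to whether the largest part is m + 1, and remove it if so. *)
Lemma size_partitions_leS (m n : nat) :
  size (partitions_le m.+1 n) =
  size (partitions_le m n) +
  (if m < n then size (partitions_le m.+1 (n - m.+1)) else 0).
Proof.
rewrite /partitions_le.
have -> : size [seq la <- partitions n | head 0 (parts la) <= m.+1] =
    size [seq la <- partitions n | head 0 (parts la) <= m] +
    size [seq la <- partitions n | head 0 (parts la) == m.+1].
  rewrite !size_filter -count_predUI addnC [X in X + _](@eq_count _ _ pred0).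
    by rewrite count_pred0; apply: eq_count => la /=; rewrite leq_eqVlt ltnS orbC.
  by move=> la /=; lia.
congr addn; rewrite -[LHS](size_map parts).
case: ltnP => mn; last first.
  apply/eqP; rewrite size_map size_filter eqn0Ngt -has_count; apply/hasPn => la.
  rewrite mem_partitions /psize => /eqP la_n.
  by case: (parts la) la_n => //= x s; lia.
rewrite -[RHS](size_map (fun la => m.+1 :: parts la)); apply/perm_size/uniq_perm.
- by rewrite map_inj_uniq ?filter_uniq ?partitions_uniq //; exact: val_inj.
- by rewrite map_inj_uniq ?filter_uniq ?partitions_uniq // => la mu [/val_inj].
move=> s; rewrite (mem_map_parts n (fun s => head 0 s == m.+1)).
rewrite (map_comp (cons m.+1) parts).
case: s => [|x s]; first by rewrite andbF; apply/esym/negbTE/negP => /mapP[].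
have [->|xm] := eqVneq x m.+1; last first.
  by rewrite !andbF; apply/esym/negbTE/negP => /mapP[s' _ [xE]]; rewrite xE eqxx in xm.
rewrite mem_map; last by move=> ? ? [].
rewrite (mem_map_parts _ (fun s => head 0 s <= m.+1)) is_part_cons /= andbT.
by rewrite andbAC -andbA; congr andb; congr andb; lia.
Qed.

Local Open Scope classical_set_scope.
Local Open Scope ring_scope.

Definition partition_gf : fps rat := Fps (fun n => (size (partitions n))%:R).
Definition partition_le_gf (m : nat) : fps rat :=
  Fps (fun n => (size (partitions_le m n))%:R).

(** By [size_partitions_leS], multiplying by 1 - q^(m+1) brings the bound m + 1 on
the parts down to m. *)
Lemma partition_le_gfE (m : nat) : partition_le_gf m * qpoch_partial m = 1.
Proof.
elim: m => [|m IHm].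
  rewrite /qpoch_partial big_geq // mulr1; apply: fpsP => n; rewrite fcoef1 /=.
  congr (_ %:R); rewrite -(size_map parts) -[RHS](size_nseq _ ([::] : seq nat)).
  apply/perm_size/uniq_perm.
  - by rewrite map_inj_uniq ?filter_uniq ?partitions_uniq //; exact: val_inj.
  - by case: eqP.
  move=> s; rewrite (mem_map_parts n (fun s => head 0 s <= 0)%N) mem_nseq.
  rewrite /is_part; case: s => [|[|x] s] /=; rewrite ?inE ?andbF ?andbT //.
  by rewrite eq_sym; case: eqP.
rewrite -[RHS]IHm /qpoch_partial big_nat_recr //= mulrA mulrAC; congr (_ * _).
apply: fpsP => n; rewrite mulrBr mulr1 fcoefD fcoefN mulrC fcoefXnM.
rewrite /= ltnS size_partitions_leS natrD.
by case: ltnP => _; rewrite ?mulr0n ?subr0 ?addr0 // addrK.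
Qed.

(** Parts and factors beyond n have no effect up to degree n. *)
Lemma partition_gfE : partition_gf = qpoch^-1.
Proof.
apply: (mulIr qpoch_unit); rewrite mulVr ?qpoch_unit //; apply: fpsP => n.
rewrite -(partition_le_gfE n) !fcoefM; apply: eq_bigr => i _.
have i_n := ltn_ord i; rewrite (@qpochE _ n) ?leq_subr //; congr (_ * _) => /=.
congr (size _)%:R; apply/esym/all_filterP/allP => la; rewrite mem_partitions => /eqP la_i.
rewrite -ltnS; apply: leq_ltn_trans i_n; rewrite -la_i /psize.
by case: (parts la) => //= x s; rewrite leq_addr.
Qed.

(** * The generating function of the defect *)

Lemma sum_intparts (n : nat) (F : intpart -> rat) :
  \sum_(la \in [set: intpart]) (F la * (n == psize la)%:R) =
  \sum_(la <- partitions n) F la.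
Proof.
rewrite [RHS](eq_big_seq (fun la => F la * (n == psize la)%:R)); last first.
  by move=> la; rewrite mem_partitions eq_sym => ->; rewrite mulr1.
rewrite [RHS]fsbig_seq ?partitions_uniq //; symmetry; apply: fsbig_widen => // la [_ /=].
by move=> /negP; rewrite mem_partitions eq_sym => /negbTE ->; rewrite mulr0.
Qed.

Lemma fcoef_dilate (m i : nat) (f : fps rat) :
  fcoef (fps_dilate m f) i = if (m %| i)%N then fcoef f (i %/ m) else 0.
Proof. by []. Qed.

Lemma fcoef0_G20 : fcoef G20 0 = 0.
Proof.
rewrite /= fsbig1 // => d d0.
by rewrite big_ord1 /= fcoefXn /= (_ : (0 == d)%N = false) ?mul0r ?mulr0 //; case: d d0.
Qed.

Lemma fcoef_dilate_G20 (m i : nat) : (0 < m)%N -> (0 < i)%N ->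
  fcoef (m%:R *: fps_dilate m G20) i =
  (if m %| i then m * \sum_(d <- divisors (i %/ m)) d else 0)%N%:R.
Proof.
move=> m0 i0; rewrite fcoefZ fcoef_dilate.
case: ifP => [dv|_]; last by rewrite mulr0.
by rewrite G20_coef ?divn_gt0 ?(dvdn_leq i0) // natrM.
Qed.

(** For j > n we have t ^ j > i, so that the coefficient of q^i can only come from
the constant term of G20, which is 0. *)
Lemma sum_dilated_G20 (t n i : nat) : (1 < t)%N -> (i <= n)%N ->
  \sum_(j \in [set j : nat | (1 <= j)%N])
     fcoef ((t ^ j)%:R *: fps_dilate (t ^ j) G20) i =
  \sum_(1 <= j < n.+1) fcoef ((t ^ j)%:R *: fps_dilate (t ^ j) G20) i.
Proof.
move=> t1 i_n; rewrite [RHS]fsbig_seq ?iota_uniq //; symmetry; apply: fsbig_widen.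
  by move=> j /=; rewrite mem_index_iota => /andP[].
move=> j [j1 /negP nj]; have {}nj : (n < j)%N.
  by move: nj; rewrite /= mem_index_iota (j1 : (0 < j)%N) /= -leqNgt.
suff : fcoef ((t ^ j)%:R *: fps_dilate (t ^ j) G20) i = 0 by [].
rewrite fcoefZ fcoef_dilate; case: ifP => [dv|]; last by rewrite mulr0.
have ltit : (i < t ^ j)%N by apply: leq_ltn_trans (ltn_expl j t1); lia.
case: i dv i_n ltit => [|i] dv i_n ltit; last by rewrite (gtnNdvd _ ltit) in dv.
by rewrite div0n fcoef0_G20 mulr0.
Qed.

Theorem corollary1p2 (t : nat) (ht : (2 <= t)%N) :
  fps_sum [set: intpart] (fun la => defect t la *: fpsX rat ^+ psize la) =
  fps_sum [set j : nat | (1 <= j)%N]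
    (fun j => (t ^ j)%:R *: fps_dilate (t ^ j) G20) / qpoch.
Proof.
rewrite -partition_gfE; apply: fpsP => n; rewrite fcoefM.
transitivity (\sum_(la <- partitions n) defect t la).
  rewrite -sum_intparts; apply: eq_fsbigr => la _.
  by rewrite fcoefZ fcoefXn.
transitivity ((\sum_(1 <= j < n.+1)
  \sum_(la <- partitions n) hooks (t ^ j) la)%N%:R : rat).
  rewrite exchange_big natr_sum /=; apply: eq_big_seq => la.
  rewrite mem_partitions => /eqP la_n; apply: defectE => //; by rewrite la_n.
under [RHS]eq_bigr => i _.
  rewrite [fcoef (fps_sum _ _) _]/= (@sum_dilated_G20 _ n) -1?ltnS //.
  rewrite mulr_suml; over.
rewrite [RHS]exchange_big natr_sum /=; apply: eq_bigr => j _.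
have tj0 : (0 < t ^ j)%N by rewrite expn_gt0 (ltnW ht).
pose c i := fcoef ((t ^ j)%:R *: fps_dilate (t ^ j) G20) i * fcoef partition_gf (n - i).
rewrite -[RHS](big_mkord xpredT c) big_ltn // [c 0%N]/c fcoefZ.
rewrite fcoef_dilate dvdn0 div0n fcoef0_G20 mulr0 mul0r add0r.
rewrite sum_hooks // natr_sum big_mkcond [LHS]big_nat_cond [RHS]big_nat_cond.
apply: eq_bigr => i; rewrite andbT => /andP[i0 _].
by rewrite /c fcoef_dilate_G20 //; case: ifP => _; rewrite ?natrM ?mul0r.
Qed.
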